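(* Let $\tau>0$ be such that $\frac{1}{\tau}$ is a positive integer, and let $G$ be a connected graph of order $n \geq 4\tau+\frac{1}{\tau}+5$. If $\lambda_1(D(G)) \leq \lambda_1\big(D(K_1 \vee (K_{n-\frac{1}{\tau}-2} \cup (\frac{1}{\tau}+1)K_1))\big)$, then $G$ is a $\tau$-tough graph, unless $G \cong K_1 \vee (K_{n-\frac{1}{\tau}-2} \cup (\frac{1}{\tau}+1)K_1)$.
   Context: All graphs are finite and simple. For a connected graph $G$ with vertex set $\{v_1,\dots,v_n\}$, the distance matrix $D(G)$ is the $n\times n$ matrix whose $(i,j)$-entry is the length of a shortest path between $v_i$ and $v_j$; $\lambda_1(D(G))$ denotes its largest eigenvalue (the distance spectral radius). For a graph $G$ and $S\subseteq V(G)$, $G-S$ is the subgraph induced by $V(G)\setminus S$ and $c(G-S)$ is its number of connected components. For a connected non-complete graph $G$, $\tau(G)=\min\left\{\frac{|S|}{c(G-S)-1} : S\subset V(G),\ c(G-S)>1\right\}$; $G$ is called $\tau$-tough if $\tau(G)\geq \tau$ (a graph admitting no $S$ with $c(G-S)>1$, e.g. a complete graph, is regarded as $\tau$-tough). $K_m$ is the complete graph on $m$ vertices, $tK_1$ is the edgeless graph on $t$ vertices, $G_1\cup G_2$ is the disjoint union, and $G_1\vee G_2$ (the join) is obtained from $G_1\cup G_2$ by adding all edges between $V(G_1)$ and $V(G_2)$. *)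

(* Defs.v *)
From HB Require Import structures.
From mathcomp Require Import all_boot all_order all_algebra.
From mathcomp Require Import classical_sets reals constructive_ereal.
From mathcomp Require Import complex polyrcf sesquilinear spectral.

Set Implicit Arguments.
Unset Strict Implicit.
Unset Printing Implicit Defensive.

Import Order.TTheory GRing.Theory Num.Theory.

Local Open Scope ring_scope.

Record sgraph := SGraph {
  vertex :> finType;
  adj : rel vertex;
  adj_sym : symmetric adj;
  adj_irrefl : irreflexive adj }.

Definition connected_graph (G : sgraph) : Prop :=
  forall x y : G, connect (@adj G) x y.

Definition graph_iso (G H : sgraph) : Prop :=
  exists f : G -> H, bijective f /\ forall x y, adj (f x) (f y) = adj x y.

Section Constructions.

Definition complete_adj (m : nat) : rel 'I_m := fun i j => i != j.

Lemma complete_adj_sym m : symmetric (@complete_adj m).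
Proof. by move=> i j; rewrite /complete_adj eq_sym. Qed.

Lemma complete_adj_irrefl m : irreflexive (@complete_adj m).
Proof. by move=> i; rewrite /complete_adj eqxx. Qed.

Definition complete_graph (m : nat) : sgraph :=
  SGraph (@complete_adj_sym m) (@complete_adj_irrefl m).

Definition edgeless_adj (t : nat) : rel 'I_t := fun _ _ => false.

Lemma edgeless_adj_sym t : symmetric (@edgeless_adj t).
Proof. by []. Qed.

Lemma edgeless_adj_irrefl t : irreflexive (@edgeless_adj t).
Proof. by []. Qed.

Definition edgeless_graph (t : nat) : sgraph :=
  SGraph (@edgeless_adj_sym t) (@edgeless_adj_irrefl t).

Variables G H : sgraph.

Definition union_adj : rel (G + H)%type := fun u v =>
  match u, v with
  | inl x, inl y => adj x y
  | inr x, inr y => adj x y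
  | _, _ => false
  end.

Lemma union_adj_sym : symmetric union_adj.
Proof. by move=> [x|x] [y|y] //=; rewrite adj_sym. Qed.

Lemma union_adj_irrefl : irreflexive union_adj.
Proof. by move=> [x|x] /=; rewrite adj_irrefl. Qed.

Definition disjoint_union : sgraph := SGraph union_adj_sym union_adj_irrefl.

Definition join_adj : rel (G + H)%type := fun u v =>
  match u, v with
  | inl x, inl y => adj x y
  | inr x, inr y => adj x y
  | _, _ => true
  end.

Lemma join_adj_sym : symmetric join_adj.
Proof. by move=> [x|x] [y|y] //=; rewrite adj_sym. Qed.

Lemma join_adj_irrefl : irreflexive join_adj.
Proof. by move=> [x|x] /=; rewrite adj_irrefl. Qed.

Definition graph_join : sgraph := SGraph join_adj_sym join_adj_irrefl.

End Constructions.

Section Induced.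
Variables (G : sgraph) (A : {set G}).

Definition induced_adj : rel {x : G | x \in A} :=
  fun x y => adj (val x) (val y).

Lemma induced_adj_sym : symmetric induced_adj.
Proof. by move=> x y; rewrite /induced_adj adj_sym. Qed.

Lemma induced_adj_irrefl : irreflexive induced_adj.
Proof. by move=> x; rewrite /induced_adj adj_irrefl. Qed.

Definition induced : sgraph := SGraph induced_adj_sym induced_adj_irrefl.

End Induced.

Definition remove_vertices (G : sgraph) (S : {set G}) : sgraph :=
  induced (~: S).

Definition num_components (G : sgraph) : nat := n_comp (@adj G) G.

(* [x :: p] lists the vertices, so the length of the path is [size p]. *)
Definition path_of_length (G : sgraph) (x y : G) (k : nat) : bool :=
  [exists p : k.-tuple G,
    [&& path (@adj G) x p, uniq (x :: p) & last x p == y]].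

(* Paths have fewer than #|G| edges, so the search range loses nothing; the  *)
(* value is #|G| (junk) when x and y are in different components.            *)
Definition gdist (G : sgraph) (x y : G) : nat :=
  find (path_of_length x y) (iota 0 #|G|).

Lemma gdistP (G : sgraph) (x y : G) : connect (@adj G) x y ->
  path_of_length x y (gdist x y) /\
  forall k, path_of_length x y k -> (gdist x y <= k)%N.
Proof.
move=> /connectP[p0 p0P ->]; case/shortenP: p0P => p pP pU _ {p0}.
have sz : (size p < #|G|)%N by rewrite -[(size p).+1]/(size (x :: p)) -(card_uniqP pU) max_card.
have pl : path_of_length x (last x p) (size p).
  by apply/existsP; exists (in_tuple p); rewrite /= pP /= in pU *; rewrite pU eqxx.
have hs : has (path_of_length x (last x p)) (iota 0 #|G|).
  by apply/hasP; exists (size p); rewrite ?mem_iota.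
split.
  have := nth_find 0%N hs; rewrite nth_iota //.
  by rewrite -[X in (_ < X)%N](size_iota 0) -has_find.
move=> k kP; rewrite leqNgt; apply/negP => lt.
have := before_find 0%N lt; rewrite nth_iota ?kP //.
by apply: leq_trans lt _; rewrite -[X in (_ <= X)%N](size_iota 0) find_size.
Qed.

Definition dist_mx (R : pzSemiRingType) (G : sgraph) : 'M[R]_#|G| :=
  \matrix_(i, j) (gdist (enum_val i) (enum_val j))%:R.

(* The set of eigenvalues is finite, and nonempty when A is symmetric of     *)
(* positive size, so the supremum is then a maximum: see lambda1P.           *)
Definition lambda1 (R : realType) (n : nat) (A : 'M[R]_n) : R :=
  sup [set a : R | eigenvalue A a]%classic.

Lemma symmetric_has_eigenvalue (R : rcfType) (n : nat) (A : 'M[R]_n) :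
  (0 < n)%N -> A^T = A -> exists a, eigenvalue A a.
Proof.
case: n A => // n A _ As.
pose f : {rmorphism R -> R[i]} := real_complex R.
pose B : 'M[R[i]]_n.+1 := map_mx f A.
have Bs : B \is symmetricmx.
  rewrite is_hermitianmxE expr0 scale1r; apply/eqP/matrixP => i j.
  by rewrite !mxE -{1}As mxE.
have Br : B \is a realmx.
  by apply/mxOverP => i j; rewrite mxE complex_real.
have Bh : B \is hermsymmx by exact: realsym_hermsym.
have /orthomx_spectralP Beq := hermitian_normalmx Bh.
have /mxOverP/(_ 0 0) := hermitian_spectral_diag_real Bh.
set d := spectral_diag B in Beq *; set P := spectralmx B in Beq.
have Pu : P \in unitmx by exact: spectral_unit.
move=> dr; have [a aE] : exists a : R, d 0 0 = f a.
  by exists (complex.Re (d 0 0)); rewrite /f /= RRe_real.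
exists a; rewrite eigenvalue_root_char -(fmorph_root f) map_char_poly.
rewrite -/B -aE -eigenvalue_root_char; apply/eigenvalueP.
exists (row 0 P).
  rewrite -row_mul {1}Beq !mulmxA mulmxV // mul1mx row_mul row_diag_mx.
  by rewrite -scalemxAl -rowE.
apply/eqP => r0; have /row_freeP[Q PQ] : row_free P by rewrite row_free_unit.
have /rowP/(_ 0) : row 0 (P *m Q) = 0 by rewrite row_mul r0 mul0mx.
by rewrite PQ !mxE eqxx => /eqP; rewrite oner_eq0.
Qed.

Lemma lambda1P (R : realType) (n : nat) (A : 'M[R]_n) :
  (0 < n)%N -> A^T = A ->
  eigenvalue A (lambda1 A) /\ forall a, eigenvalue A a -> a <= lambda1 A.
Proof.
move=> n0 As; have [a0 a0A] := symmetric_has_eigenvalue n0 As.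
have p0 : char_poly A != 0 by rewrite -size_poly_eq0 size_char_poly.
have memE a : eigenvalue A a = (a \in rootsR (char_poly A)).
  by rewrite eigenvalue_root_char -roots_on_rootsR // in_itv.
have [m mr mmax] : exists2 m, m \in rootsR (char_poly A) &
    forall a, a \in rootsR (char_poly A) -> a <= m.
  move: a0A; rewrite memE; elim: (rootsR _) a0 => // x s IH a0 _.
  case: s IH => [_|y s IH].
    by exists x => [|a]; rewrite ?mem_head // inE => /eqP->.
  have [m ms mm] := IH y (mem_head _ _).
  have [mx|xm] := leP m x.
    exists x => [|a]; first exact: mem_head.
    by rewrite in_cons => /orP[/eqP->//|/mm/le_trans->].
  exists m => [|a]; first by rewrite in_cons ms orbT.
  by rewrite in_cons => /orP[/eqP->|/mm//]; exact: ltW.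
suff -> : lambda1 A = m by split=> [|a]; rewrite memE //; exact: mmax.
have mub : ubound [set a | eigenvalue A a]%classic m.
  by move=> a /=; rewrite memE; exact: mmax.
apply/eqP; rewrite eq_le; apply/andP; split.
  by apply: ge_sup => //; exists a0.
by apply: ub_le_sup; [exists m | rewrite /= memE].
Qed.

(* The neutral element +oo is the value for graphs without any vertex cut,   *)
(* so that these are t-tough for every t.                                    *)
Definition toughness (R : realType) (G : sgraph) : \bar R :=
  \big[Order.min/+oo%E]_(S : {set G} |
      (1 < num_components (remove_vertices S))%N)
    (#|S|%:R / ((num_components (remove_vertices S))%:R - 1))%:E.

Definition tough (R : realType) (t : R) (G : sgraph) : Prop :=
  (t%:E <= toughness R G)%E.

Lemma toughP (R : realType) (t : R) (G : sgraph) :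
  tough t G <->
  forall S : {set G}, (1 < num_components (remove_vertices S))%N ->
    t <= #|S|%:R / ((num_components (remove_vertices S))%:R - 1).
Proof.
rewrite /tough /toughness; split=> [/bigmin_geP[_ h] S /h|h].
  by rewrite lee_fin.
by apply/bigmin_geP; split=> [|S /h]; rewrite ?leey ?lee_fin.
Qed.

Definition extremal_graph (n k : nat) : sgraph :=
  graph_join (complete_graph 1)
    (disjoint_union (complete_graph (n - k - 2)) (edgeless_graph k.+1)).

(* Main.v *)
Require Import Defs.
From mathcomp Require Import all_boot all_order all_algebra.
From mathcomp Require Import reals.
From mathcomp Require Import complex sesquilinear spectral.
From mathcomp Require Import zify ring lra.

(* If G is not tau-tough, some set S of s vertices leaves at least ks + 2      *)
(* components. For a nonnegative vector x on the vertices, lambda1(D(G)) |x|^2 *)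
(* is at least the sum of d(u,v) x_u x_v, where d(u,v) >= 2 for nonadjacent u  *)
(* and v. Take one vertex in each of ks + 1 components other than a largest    *)
(* one, and let x be the Perron vector of the extremal graph, with its entry a *)
(* at the centre placed on a vertex of S, its entries c at the k + 1 isolated  *)
(* vertices placed on chosen vertices, and b elsewhere. Since c < 2b, moving   *)
(* the other vertices of the ks + 1 components to the largest one does not     *)
(* increase the form. Comparing with lambda |x|^2 leaves                       *)
(* (s-1) b (k (2M + k(s-1) - 1) b - 2 (k+1) c), where M is the number of       *)
(* vertices that are neither in S nor chosen. For s = 1 it vanishes and the    *)
(* equality case gives an isomorphism. For s >= 2 it is positive, except when  *)
(* k = M = 1 and s is 4, 5 or 6, where another vector does.                    *)

Set Implicit Arguments.
Unset Strict Implicit.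
Unset Printing Implicit Defensive.

Import Order.TTheory GRing.Theory Num.Theory.

Local Open Scope ring_scope.

(** Two bounds on spectral radii are played against each other. [lambda1_dist_ge] turns any test
    vector on [G] into a lower bound, while [extremal_lambda1_le] bounds the extremal graph from
    above by any number that has a positive solution of its quotient eigenvalue equations. The cut
    enters only through [block_form_le], a lower estimate of the distance form of [G]; [perron_gap]
    and [block_correction] evaluate that estimate on the transplanted Perron vector, and [gap_nat]
    settles the sign of what remains. Cuts of one vertex end in [cut_single_iso], larger ones in
    [cut_gap_false] or [cut_exception_false]. *)

(** * The Rayleigh bound for real symmetric matrices *)

(** The matrix is diagonalized by a unitary [P] over the complex extension. In the coordinates [w]
    the form is the sum of [d i * |w i|^2] and the squared norm is the sum of [|w i|^2], so it is
    enough that every [d i] is at most [lambda1 A]. *)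
Lemma lambda1_rayleigh (R : realType) (n : nat) (A : 'M[R]_n) (v : 'rV[R]_n) :
  A^T = A -> (v *m A *m v^T) 0 0 <= lambda1 A * (v *m v^T) 0 0.
Proof.
case: n A v => [|n] A v As.
  by rewrite !mxE !big_ord0 mulr0.
pose f : {rmorphism R -> R[i]} := real_complex R.
pose B : 'M[R[i]]_n.+1 := map_mx f A.
pose y : 'rV[R[i]]_n.+1 := map_mx f v.
have Bs : B \is symmetricmx.
  rewrite is_hermitianmxE expr0 scale1r; apply/eqP/matrixP => i j.
  by rewrite !mxE -{1}As mxE.
have Br : B \is a realmx.
  by apply/mxOverP => i j; rewrite mxE complex_real.
have Bh : B \is hermsymmx by exact: realsym_hermsym.
have /orthomx_spectralP Beq := hermitian_normalmx Bh.
have dr := hermitian_spectral_diag_real Bh.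
set d := spectral_diag B in Beq dr *; set P := spectralmx B in Beq.
have Pu : P \in unitmx by exact: spectral_unit.
have Puni : P \is unitarymx by exact: spectral_unitarymx.
have Pinv : invmx P = P^t*%sesqui by exact: invmx_unitary.
have dE i : d 0 i <= f (lambda1 A).
  have dri : d 0 i \is Num.real by exact: (mxOverP dr).
  have [a aE] : exists a : R, d 0 i = f a.
    by exists (complex.Re (d 0 i)); rewrite /f /= RRe_real.
  rewrite aE /f /= lecR; apply: (lambda1P (ltn0Sn n) As).2.
  (* The eigenvector found here is complex, but [a] is real and being an eigenvalue is read off the
     characteristic polynomial, so it descends to [A]. *)
  rewrite eigenvalue_root_char -(fmorph_root f) map_char_poly.
  rewrite -/B -aE -eigenvalue_root_char; apply/eigenvalueP.
  exists (row i P).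
    rewrite -row_mul {1}Beq !mulmxA mulmxV // mul1mx row_mul row_diag_mx.
    by rewrite -scalemxAl -rowE.
  apply/eqP => r0; have /row_freeP[Q PQ] : row_free P by rewrite row_free_unit.
  have /rowP/(_ i) : row i (P *m Q) = 0 by rewrite row_mul r0 mul0mx.
  by rewrite PQ !mxE eqxx => /eqP; rewrite oner_eq0.
pose w := y *m P^t*%sesqui.
have yt : y^t*%sesqui = map_mx f v^T.
  apply/matrixP => i j; rewrite !mxE.
  by apply: CrealP; rewrite /f /= complex_real.
have Pyt : P *m map_mx f v^T = w^t*%sesqui.
  by rewrite -yt /w trmx_mul map_mxM /= trmxCK.
have e1 : f ((v *m A *m v^T) 0 0) = \sum_i d 0 i * `|w 0 i| ^+ 2.
  have -> : f ((v *m A *m v^T) 0 0) = (map_mx f (v *m A *m v^T)) 0 0.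
    by rewrite [RHS]mxE.
  rewrite !map_mxM -/B -/y Beq Pinv !mulmxA -/w -mulmxA Pyt mxE.
  apply: eq_bigr => i _; rewrite mul_mx_diag !mxE normCK.
  by rewrite mulrAC mulrC.
have e2 : f ((v *m v^T) 0 0) = \sum_i `|w 0 i| ^+ 2.
  have -> : f ((v *m v^T) 0 0) = (map_mx f (v *m v^T)) 0 0 by rewrite [RHS]mxE.
  rewrite map_mxM -/y -[y](mulmxKV Pu) Pinv -/w -mulmxA Pyt mxE.
  by apply: eq_bigr => i _; rewrite !mxE normCK.
have: f ((v *m A *m v^T) 0 0) <= f (lambda1 A * (v *m v^T) 0 0).
  rewrite rmorphM e1 e2 mulr_sumr; apply: ler_sum => i _.
  by apply: ler_wpM2r; rewrite ?exprn_ge0.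
by rewrite /f /= lecR.
Qed.

(** * Elementary facts on graph distance *)

Lemma gdist_eq0 (G : sgraph) (x : G) : gdist x x = 0%N.
Proof.
have [_ /(_ 0%N)] := gdistP (connect0 (@adj G) x).
rewrite leqn0 => h; apply/eqP/h.
by apply/existsP; exists [tuple]; rewrite /= eqxx.
Qed.

Lemma gdist_ge (G : sgraph) (x y : G) : connect (@adj G) x y -> x != y ->
  (1 + ~~ adj x y <= gdist x y)%N.
Proof.
move=> /gdistP[+ _] nxy; case: (gdist x y) => [|[|d]].
- case/existsP=> p; rewrite [p]tuple0 /= => /eqP xy.
  by rewrite xy eqxx in nxy.
- case/existsP=> -[[|z [|]] //= _]; rewrite andbT.
  by case/and3P=> axy _ /eqP <-; rewrite axy.
- by move=> _; case: (adj x y).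
Qed.

Lemma gdist_adj (G : sgraph) (x y : G) : adj x y -> (gdist x y <= 1)%N.
Proof.
move=> axy; have [_] := gdistP (connect1 axy); apply.
apply/existsP; exists [tuple y]; rewrite /= axy eqxx inE !andbT.
by apply: contraTneq axy => ->; rewrite adj_irrefl.
Qed.

Lemma gdist_le2 (G : sgraph) (x z y : G) : adj x z -> adj z y ->
  (gdist x y <= 2)%N.
Proof.
move=> axz azy; have [<-|nxy] := eqVneq x y; first by rewrite gdist_eq0.
have [_] := gdistP (connect_trans (connect1 axz) (connect1 azy)); apply.
apply/existsP; exists [tuple z; y]; rewrite /= axz azy eqxx !inE /= !andbT.
rewrite negb_or nxy andbT; apply/andP; split.
  by apply: contraTneq axz => ->; rewrite adj_irrefl.
by apply: contraTneq azy => ->; rewrite adj_irrefl.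
Qed.

Lemma gdist_sym (G : sgraph) (x y : G) : gdist x y = gdist y x.
Proof.
rewrite /gdist; apply: eq_find => d.
suff sub (u v : G) : path_of_length u v d -> path_of_length v u d.
  by apply/idP/idP; exact: sub.
case/existsP=> p /and3P[up uu /eqP lu].
have sz : size (rev (belast u p)) == d.
  by rewrite size_rev size_belast size_tuple.
have e : v :: rev (belast u p) = rev (u :: p).
  by rewrite [u :: _]lastI rev_rcons lu.
apply/existsP; exists (Tuple sz); rewrite /= -[_ && uniq _]/(uniq (_ :: _)) e.
rewrite rev_uniq uu /= -[X in path _ X]lu rev_path.
rewrite (eq_path (e' := @adj G)) ?up; last first.
  by move=> a b; rewrite /= adj_sym.
have -> : last v (rev (belast u p)) = last v (rev (u :: p)) by rewrite -e.
by rewrite rev_cons last_rcons eqxx.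
Qed.

(** * Bounds on the distance spectral radius by test vectors *)

Section DistanceForm.
Variables (R : realType) (G : sgraph).

Lemma dist_mx_sym : (dist_mx R G)^T = dist_mx R G.
Proof. by apply/matrixP => i j; rewrite !mxE gdist_sym. Qed.

Lemma lambda1_dist_ge (x : G -> R) :
  \sum_u \sum_v (gdist u v)%:R * x u * x v <=
  lambda1 (dist_mx R G) * \sum_u x u ^+ 2.
Proof.
pose v : 'rV[R]_#|G| := \row_i x (enum_val i).
have := lambda1_rayleigh v dist_mx_sym.
have sumE (g : G -> R) : \sum_u g u = \sum_(i < #|G|) g (enum_val i).
  by rewrite (reindex (@enum_val G G)) //; exact/onW_bij/enum_val_bij.
congr (_ <= _ * _).
- rewrite mxE exchange_big sumE; apply: eq_bigr => j _.
  rewrite mxE mulr_suml sumE; apply: eq_bigr => i _.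
  by rewrite !mxE; ring.
- by rewrite mxE sumE; apply: eq_bigr => i _; rewrite !mxE.
Qed.

(* Pairing the eigenvalue equation of an arbitrary eigenvector, taken in      *)
(* absolute value, with the positive vector x.                                *)
Lemma lambda1_dist_le (x : G -> R) (l : R) : (0 < #|G|)%N ->
  (forall u, 0 < x u) ->
  (forall u, \sum_v (gdist u v)%:R * x v <= l * x u) ->
  lambda1 (dist_mx R G) <= l.
Proof.
move=> G0 x0 xl; have [+ _] := lambda1P G0 dist_mx_sym.
set mu := lambda1 _ => /eigenvalueP[v vE v0].
pose y (u : G) := `|v 0 (enum_rank u)|.
have sumE (g : G -> R) : \sum_u g u = \sum_(i < #|G|) g (enum_val i).
  by rewrite (reindex (@enum_val G G)) //; exact/onW_bij/enum_val_bij.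
have ymu u : mu * y u <= \sum_w (gdist w u)%:R * y w.
  have /rowP/(_ (enum_rank u)) := vE; rewrite !mxE => e.
  apply: le_trans (_ : `|mu * v 0 (enum_rank u)| <= _).
    by rewrite normrM ler_wpM2r ?normr_ge0 ?ler_norm.
  rewrite -e sumE; apply: le_trans (ler_norm_sum _ _ _) _.
  apply: ler_sum => i _; rewrite mxE enum_rankK normrM normr_nat mulrC.
  by rewrite /y enum_valK.
have sum_gt0 : 0 < \sum_u x u * y u.
  rewrite lt0r sumr_ge0 ?andbT => [|u _]; last first.
    by rewrite mulr_ge0 ?normr_ge0 ?ltW.
  apply: contraNneq v0 => /eqP; rewrite psumr_eq0 => [/allP h|u _]; last first.
    by rewrite mulr_ge0 ?normr_ge0 ?ltW.
  apply/eqP/rowP => i; rewrite mxE; have := h (enum_val i) (mem_index_enum _).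
  by rewrite /= mulf_eq0 gt_eqF //= /y enum_valK normr_eq0 => /eqP.
rewrite -(ler_pM2r sum_gt0) mulr_sumr.
apply: le_trans (_ : \sum_u x u * \sum_w (gdist w u)%:R * y w <= _).
  apply: ler_sum => u _; rewrite mulrCA; apply: ler_wpM2l (ymu u).
  exact: ltW.
rewrite (eq_bigr (fun u => \sum_w (gdist w u)%:R * x u * y w)) => [|u _].
  rewrite exchange_big mulr_sumr; apply: ler_sum => w _.
  rewrite -mulr_suml mulrA; apply: ler_wpM2r; first exact: normr_ge0.
  exact: xl.
by rewrite mulr_sumr; apply: eq_bigr => w _; ring.
Qed.

End DistanceForm.

(** * The spectral radius and Perron vector of the extremal graph *)

Section ExtremalGraph.
Variables (R : realType) (n k : nat).
Local Notation m := ((n - k - 2)%:R : R).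
Local Notation t := (k.+1%:R : R).

Lemma sum_neq_ord (p : nat) (i : 'I_p) (r : R) :
  \sum_(j < p) (j != i)%:R * r = (p%:R - 1) * r.
Proof.
rewrite (bigD1 i) //= eqxx mul0r add0r.
rewrite (eq_bigr (fun=> r)) => [|j ->]; last by rewrite mul1r.
rewrite sumr_const cardC1 card_ord -[r *+ _]mulr_natl; case: p i => [[]|p i] //.
by rewrite /= -[p.+1%:R]natr1 addrK.
Qed.

(** The equations say that the vector with entries [a] at the centre, [b] on the clique and [c] on
    the isolated vertices is an eigenvector. By [lambda1_dist_le], upper estimates of distances
    suffice: 1 for adjacent vertices and 2, through the centre [z], for all others. *)
Lemma extremal_lambda1_le (a b c l : R) : 0 < a -> 0 < b -> 0 < c ->
  l * a = m * b + t * c ->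
  l * b = a + (m - 1) * b + 2 * t * c ->
  l * c = a + 2 * m * b + 2 * (t - 1) * c ->
  lambda1 (dist_mx R (extremal_graph n k)) <= l.
Proof.
move=> a0 b0 c0 ea eb ec.
pose x (u : extremal_graph n k) : R :=
  match u with inl _ => a | inr (inl _) => b | inr (inr _) => c end.
pose z : extremal_graph n k := inl ord0.
have x0 u : 0 < x u by case: u => [|[]].
have gd1 (u v : extremal_graph n k) : adj u v -> (gdist u v)%:R * x v <= x v.
  move=> /gdist_adj d; apply: ler_piMl; first exact: ltW.
  by rewrite lern1.
have gdn (u v : extremal_graph n k) : adj u v ->
    (gdist u v)%:R * x v <= (v != u)%:R * x v.
  move=> auv; have -> : v != u.
    by apply: contraTneq auv => ->; rewrite adj_irrefl.
  by rewrite mul1r gd1.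
have gd2 (u v : extremal_graph n k) : (gdist u v)%:R * x v <= 2 * ((v != u)%:R * x v).
  have [->|nvu] := eqVneq v u; first by rewrite gdist_eq0 !mul0r mulr0.
  rewrite mul1r; apply: ler_wpM2r; first exact: ltW.
  rewrite (ler_nat R _ 2).
  case: u v nvu => [u|u] [v|v] nvu; last exact: (@gdist_le2 _ _ z).
  - by rewrite !(ord1 u, ord1 v) eqxx in nvu.
  - by apply: leq_trans (gdist_adj _) _.
  - by apply: leq_trans (gdist_adj _) _.
apply: (@lambda1_dist_le _ _ x) => //; first by apply/card_gt0P; exists z.
have sum1 (f : 'I_1 -> R) : \sum_(i < 1) f i = f ord0 by rewrite big_ord1.
case=> [i|[j|h]]; rewrite !big_sumType /= sum1.
- rewrite ord1 gdist_eq0 mul0r add0r ea; apply: lerD.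
    apply: le_trans (ler_sum (G := fun=> b) _ _) _ => [j _|]; first exact: gd1.
    by rewrite sumr_const card_ord mulr_natl.
  apply: le_trans (ler_sum (G := fun=> c) _ _) _ => [j _|]; first exact: gd1.
  by rewrite sumr_const card_ord mulr_natl.
- rewrite eb -addrA; apply: lerD; first exact: gd1.
  apply: lerD.
    rewrite -(sum_neq_ord j); apply: ler_sum => j' _.
    have [->|ne] := eqVneq j' j; first by rewrite gdist_eq0 !mul0r.
    by rewrite mul1r; apply: gd1; rewrite /= /complete_adj eq_sym.
  apply: le_trans (ler_sum (G := fun=> 2 * c) _ _) _ => [j' _|].
    by apply: le_trans (gd2 _ _) _; rewrite mul1r.
  by rewrite sumr_const card_ord -mulr_natl; lra.
- rewrite ec -addrA; apply: lerD; first exact: gd1.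
  apply: lerD.
    apply: le_trans (ler_sum (G := fun=> 2 * b) _ _) _ => [j' _|].
      by apply: le_trans (gd2 _ _) _; rewrite mul1r.
    by rewrite sumr_const card_ord -mulr_natl; lra.
  rewrite -mulrA -(sum_neq_ord h) mulr_sumr; apply: ler_sum => h' _.
  exact: gd2.
Qed.

End ExtremalGraph.

(* The characteristic cubic of the quotient matrix on the three vertex classes *)
(* of the extremal graph, of sizes 1, m and t.                                 *)
Definition extremal_cubic (R : realType) (m t l : R) : R :=
  l ^+ 2 * (l + 2) - (l * (m - 1) + m) * (l + 2) - t * (2 * l + 1) * (m + l + 1).

Lemma extremal_cubic_root (R : realType) (m t lo hi : R) : lo <= hi ->
  extremal_cubic m t lo <= 0 -> 0 <= extremal_cubic m t hi ->
  exists l : R, [/\ lo <= l, l <= hi & extremal_cubic m t l = 0].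
Proof.
move=> lohi plo phi.
pose p : {poly R} := 'X ^+ 2 * ('X + 2%:P) -
  ('X * (m - 1)%:P + m%:P) * ('X + 2%:P) -
  t%:P * (2%:P * 'X + 1%:P) * (m%:P + 'X + 1%:P).
have pE l : p.[l] = extremal_cubic m t l by rewrite /p /extremal_cubic !hornerE; ring.
have pp : p.[lo] <= 0 <= p.[hi] by rewrite !pE plo.
have [l /andP[lol lhi] /rootP pl] := poly_ivt lohi pp.
by exists l; split=> //; rewrite -pE.
Qed.

(** Subtracting the second equation from the third gives [(l + 2) c = (m + l + 1) b], which dictates
    [b] and [c]. The first equation then defines [a], and the second becomes the cubic. *)
Lemma extremal_eigenvector (R : realType) (m t l : R) :
  0 <= m -> 0 < t -> 0 < l -> extremal_cubic m t l = 0 ->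
  let b := l + 2 in let c := m + l + 1 in
  exists a : R, [/\ 0 < a, l * a = m * b + t * c,
    l * b = a + (m - 1) * b + 2 * t * c &
    l * c = a + 2 * m * b + 2 * (t - 1) * c].
Proof.
move=> m0 t0 l0 ql b c; rewrite /extremal_cubic in ql.
have b0 : 0 < b by rewrite /b; lra.
have c0 : 0 < c by rewrite /c; lra.
have ln : l != 0 by rewrite gt_eqF.
pose a := (m * b + t * c) / l.
have ea : l * a = m * b + t * c by rewrite /a; field.
have eb : l * b = a + (m - 1) * b + 2 * t * c.
  apply: (mulfI ln); rewrite !mulrDr ea /b /c.
  by move: ql; lra.
exists a; split=> //.
  by rewrite divr_gt0 // ltr_wpDl ?mulr_ge0 ?mulr_gt0 // ltW.
by move: eb; rewrite /b /c; lra.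
Qed.

(** The cubic changes sign between [m + t + 3] and [2 (m + t + 2)]. After shifting to [x = m - 4]
    and [y = t - 2] both signs follow linearly from the nonnegativity of the monomials and from
    [x + y >= 1]; at [x = y = 0] the cubic takes the value 18 at the lower end. *)
Lemma extremal_cubic_root_ge (R : realType) (m t : R) :
  2 <= t -> 4 <= m -> 7 <= m + t ->
  exists2 l : R, m + t + 3 <= l & extremal_cubic m t l = 0.
Proof.
move=> t2 m4 mt; pose x := m - 4; pose y := t - 2.
have x0 : 0 <= x by rewrite /x; lra.
have y0 : 0 <= y by rewrite /y; lra.
have mE : m = x + 4 by rewrite /x; ring.
have tE : t = y + 2 by rewrite /y; ring.
have xy1 : 1 <= x + y by rewrite /x /y; lra.
have mono : [/\ 0 <= x * y, 0 <= x * x, 0 <= y * y & [/\ 0 <= x * x * y,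
    0 <= x * y * y, 0 <= y * y * y & 0 <= x * x * x]].
  by split; [| | | split]; rewrite !mulr_ge0.
case: mono => xy xx yy [xxy xyy yyy xxx].
have [|||l [lo hi lE]] :=
  @extremal_cubic_root R m t (m + t + 3) (2 * (m + t + 2)).
- by lra.
- by rewrite /extremal_cubic mE tE; lra.
- by rewrite /extremal_cubic mE tE; lra.
by exists l.
Qed.

(** * Components left by a vertex cut *)

Lemma exists_subset_card (T : finType) (A : {set T}) (q : nat) :
  (q <= #|A|)%N -> exists2 B : {set T}, B \subset A & #|B| = q.
Proof.
move=> qA; exists [set x in take q (enum A)].
  by apply/subsetP => x; rewrite inE => /mem_take; rewrite mem_enum.
rewrite cardsE (card_uniqP (take_uniq _ (enum_uniq _))) size_takel //.
by rewrite -cardE.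
Qed.

Section VertexCut.
Variables (G : sgraph) (S : {set G}).
Let H := remove_vertices S.
Let e := @adj H.

Lemma remove_connect_sym : connect_sym e.
Proof. by apply: sym_connect_sym => x y; rewrite /e adj_sym. Qed.

Lemma num_components_roots :
  num_components H = #|[set r : H | fingraph.roots e r]|.
Proof.
by rewrite cardsE; apply: eq_card => r; rewrite !inE andbT.
Qed.

Lemma cut_nonempty : connected_graph G -> (1 < num_components H)%N ->
  (0 < #|S|)%N.
Proof.
move=> cG; rewrite lt0n cards_eq0; apply: contraTneq => S0.
have conn (x y : H) : connect e x y.
  have /connectP[p] := cG (val x) (val y).
  elim: p x => [|z p IH] x /= => [_ /val_inj ->|/andP[axz pz] yE].
    exact: connect0.
  have zS : z \in ~: S by rewrite S0 inE inE.
  apply: connect_trans (IH (Sub z zS) pz yE).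
  exact/connect1.
rewrite -leqNgt num_components_roots; apply/card_le1_eqP => r r'.
rewrite !inE => /eqP rE /eqP rE'.
by rewrite -rE -rE'; apply/eqP; rewrite (root_connect remove_connect_sym).
Qed.

(* [U] consists of [q] component roots and [rho] sends a vertex to the root of *)
(* its component. The last two clauses hold because the component left out     *)
(* of the choice of [U] is a largest one.                                      *)
Lemma cut_blocks (q : nat) : (q < num_components H)%N ->
  exists (rho : G -> G) (U : {set G}),
  [/\ #|U| = q,
      forall u, u \in U -> u \notin S /\ rho u = u,
      forall u v, u \notin S -> v \notin S -> adj u v -> rho u = rho v,
      (0 < #|[set v | (v \notin S) && (rho v \notin U)]|)%N &
      forall z, z \notin S -> z \notin U -> rho z \in U ->
        (1 < #|[set v | (v \notin S) && (rho v \notin U)]|)%N].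
Proof.
rewrite num_components_roots; set Rt := [set r | _] => qlt.
have [r1 r1R] : exists r1, r1 \in Rt by apply/card_gt0P; apply: leq_ltn_trans qlt.
pose C r := [set x : H | fingraph.root e x == r].
(* [r0] is the root of a largest component; [U] is chosen among the other roots. *)
case: (@arg_maxnP _ r1 (mem Rt) (fun r => #|C r|) r1R) => r0 r0R r0max.
have {}r0R : r0 \in Rt by [].
have qle : (q <= #|Rt :\ r0|)%N by rewrite (cardsD1 r0) r0R in qlt.
have [U' U'R cU'] := exists_subset_card qle.
(* On [S] the value is a mere default: every clause about [rho] concerns vertices off [S]. *)
pose rho (v : G) : G :=
  if insub v is Some x then val (fingraph.root e (x : H)) else v.
have rhoE (x : H) : rho (val x) = val (fingraph.root e x).
  by rewrite /rho valK.
have HP (v : G) : v \notin S -> exists x : H, v = val x.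
  by rewrite -in_setC => vS; exists (Sub v vS).
have HN (x : H) : val x \notin S by rewrite -in_setC (valP x).
have inU (x : H) : (val x \in val @: U') = (x \in U').
  exact: mem_imset val_inj.
have rU x : x \in U' -> x != r0 /\ fingraph.root e x = x.
  by move=> /(subsetP U'R); rewrite !inE => /andP[-> /eqP ->].
pose B0 (U : {set G}) := [set v | (v \notin S) && (rho v \notin U)].
have subB : val @: C r0 \subset B0 (val @: U').
  apply/subsetP => _ /imsetP[x + ->]; rewrite !inE HN rhoE inU => /eqP ->.
  by apply/negP => /rU[]; rewrite eqxx.
have cB : (#|C r0| <= #|B0 (val @: U')|)%N.
  by rewrite -(card_imset _ (@val_inj _ _ H)) subset_leq_card.
exists rho, (val @: U'); split.
- by rewrite card_imset //; exact: val_inj.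
- by move=> _ /imsetP[x xU ->]; rewrite HN rhoE (rU _ xU).2.
- move=> u v /HP[x ->] /HP[y ->] axy; rewrite !rhoE; congr val.
  by apply/eqP; rewrite (root_connect remove_connect_sym); exact: connect1.
- apply: leq_trans cB; apply/card_gt0P; exists r0; rewrite inE.
  by move: r0R; rewrite inE.
move=> z /HP[x ->]; rewrite rhoE !inU => xU rxU.
apply: leq_trans cB; apply: leq_trans (r0max (fingraph.root e x) _); last first.
  suff: fingraph.root e x \in Rt by [].
  by rewrite in_set; exact: roots_root remove_connect_sym _.
(* The component of [x] contains [x] and its root, so the largest one also has at least two
   vertices. *)
have xr : x != fingraph.root e x by apply: contraNneq xU => ->.
apply: leq_trans (subset_leq_card (A := [set x; fingraph.root e x]) _).
  by rewrite cards2 xr.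
by apply/subsetP => y; rewrite !inE => /orP[]/eqP ->; rewrite ?(rU _ rxU).2.
Qed.

End VertexCut.

(** * A lower estimate of the distance form from the cut *)

Section BlockForm.
Variables (R : realType) (G : sgraph) (S U : {set G}) (rho : G -> G).
Hypothesis connG : connected_graph G.
Hypothesis rhoU : forall u, u \in U -> u \notin S /\ rho u = u.
Hypothesis rho_adj :
  forall u v, u \notin S -> v \notin S -> adj u v -> rho u = rho v.

Let W := ~: (S :|: U).
Let B := [set v | (v \notin S) && (rho v \notin U)].
Let Z := [set v | [&& v \notin S, v \notin U & rho v \in U]].

(* The first five terms are the distances of the join of [S] with the disjoint *)
(* union of a clique on [W] and the isolated vertices [U]; the other four      *)
(* correct for the vertices of [Z], which lie in the components of vertices    *)
(* of [U] rather than in that of [W].                                          *)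
Definition block_dist (u v : G) : R :=
  1 - (u == v)%:R + (u \in ~: S)%:R * (v \in ~: S)%:R
  - (u \in W)%:R * (v \in W)%:R - (u \in U)%:R * (u == v)%:R
  - (u \in Z)%:R * (v == rho u)%:R - (v \in Z)%:R * (u == rho v)%:R
  + (u \in Z)%:R * (v \in B)%:R + (v \in Z)%:R * (u \in B)%:R.

(** Distinct vertices are at distance at least 1, and at least 2 if nonadjacent; off [S], adjacent
    vertices share their [rho]. So two vertices of [U] are nonadjacent, and so are a vertex of [Z]
    and one of [B], while [z] in [Z] may be adjacent to [rho z], for which only 1 is claimed. *)
Lemma block_dist_le (u v : G) : block_dist u v <= (gdist u v)%:R.
Proof.
rewrite /block_dist !inE.
have [<-|nuv] := eqVneq u v.
  rewrite gdist_eq0; have := @rhoU u.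
  case: (u \in S); case: (u \in U); case: (rho u \in U);
    case: (u == rho u) => //= h; first [by have [] := h isT | lra].
have := gdist_ge (connG u v) nuv; rewrite -(ler_nat R) natrD.
apply: le_trans.
have [uS|uS] := boolP (u \in S).
  have h : 0 <= [&& v \notin S, v \notin U & rho v \in U]%:R *
      (u == rho v)%:R :> R by rewrite mulr_ge0.
  have : 0 <= (~~ adj u v)%:R :> R by [].
  rewrite /= in h *; lra.
have [vS|vS] := boolP (v \in S).
  have h : 0 <= ((u \notin U) && (rho u \in U))%:R *
      (v == rho u)%:R :> R by rewrite mulr_ge0.
  have : 0 <= (~~ adj u v)%:R :> R by [].
  rewrite /= in h *; lra.
have [/(rho_adj uS vS) ruv|_] := boolP (adj u v).
  have [uU|uU] := boolP (u \in U); have [vU|vU] := boolP (v \in U) => /=.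
  - by move: nuv; rewrite -(rhoU uU).2 ruv (rhoU vU).2 eqxx.
  - rewrite -ruv (rhoU uU).2 uU eqxx /=; lra.
  - rewrite ruv (rhoU vU).2 vU eqxx /=; lra.
  - rewrite ruv; case: (rho v \in U) => /=; last lra.
    have : 0 <= (v == rho v)%:R :> R by [].
    have : 0 <= (u == rho v)%:R :> R by [].
    lra.
have e1 : 0 <= (v == rho u)%:R :> R by [].
have e2 : 0 <= (u == rho v)%:R :> R by [].
have [uU|uU] := boolP (u \in U); have [vU|vU] := boolP (v \in U) => /=;
  rewrite ?(rhoU uU).2 ?(rhoU vU).2 ?uU ?vU /=.
- lra.
- by case: (rho v \in U) => /=; lra.
- by case: (rho u \in U) => /=; lra.
- by case: (rho u \in U); case: (rho v \in U) => /=; lra.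
Qed.

(** The quadratic form of [block_dist], collected by vertex classes so that it can be evaluated on
    vectors with few values; the last sum isolates the contribution of [Z]. *)
Definition block_form (x : G -> R) : R :=
  (\sum_u x u) ^+ 2 - \sum_u x u ^+ 2 + (\sum_(u in ~: S) x u) ^+ 2
  - (\sum_(u in W) x u) ^+ 2 - \sum_(u in U) x u ^+ 2
  + 2 * \sum_(z in Z) x z * (\sum_(v in B) x v - x (rho z)).

Lemma block_formE (x : G -> R) :
  \sum_u \sum_v block_dist u v * x u * x v = block_form x.
Proof.
have ind (A : {set G}) (f : G -> R) :
    \sum_(v in A) f v = \sum_v (v \in A)%:R * f v.
  by rewrite big_mkcond; apply: eq_bigr => v _; case: (v \in A); rewrite ?mul1r ?mul0r.
have delta (w : G) (f : G -> R) : \sum_v (v == w)%:R * f v = f w.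
  rewrite (bigD1 w) //= eqxx mul1r big1 ?addr0 // => v /negPf ->.
  by rewrite mul0r.
pose Y u := \sum_v (v \in Z)%:R * (u == rho v)%:R * x v.
have YE : \sum_u x u * Y u = \sum_(z in Z) x z * x (rho z).
  rewrite (eq_bigr (fun u => \sum_v (u == rho v)%:R * (x u * ((v \in Z)%:R * x v)))).
    rewrite exchange_big ind; apply: eq_bigr => v _ /=.
    by rewrite delta; ring.
  by move=> u _; rewrite mulr_sumr; apply: eq_bigr => v _; ring.
rewrite (eq_bigr (fun u => x u * (\sum_v x v) - x u ^+ 2
  + (u \in ~: S)%:R * x u * \sum_(v in ~: S) x v
  - (u \in W)%:R * x u * \sum_(v in W) x v
  - (u \in U)%:R * x u ^+ 2
  - (u \in Z)%:R * (x u * x (rho u)) - x u * Y u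
  + (u \in Z)%:R * x u * \sum_(v in B) x v
  + (u \in B)%:R * x u * \sum_(v in Z) x v)); last first.
  move=> u _.
  have -> : x u ^+ 2 = \sum_v (v == u)%:R * (x u * x v).
    by rewrite delta expr2.
  have -> : x u * x (rho u) = \sum_v (v == rho u)%:R * (x u * x v).
    by rewrite delta.
  rewrite /Y !ind !mulr_sumr -!sumrN -!big_split /=.
  by apply: eq_bigr => v _; rewrite /block_dist [u == v]eq_sym; ring.
rewrite !big_split /= !sumrN -!mulr_suml YE.
rewrite -!ind /block_form.
have -> : \sum_(z in Z) x z * (\sum_(v in B) x v - x (rho z)) =
    (\sum_(z in Z) x z) * (\sum_(v in B) x v) - \sum_(z in Z) x z * x (rho z).
  by rewrite mulr_suml -sumrB; apply: eq_bigr => z _; rewrite mulrBr.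
ring.
Qed.

Lemma block_form_le (x : G -> R) : (forall u, 0 <= x u) ->
  block_form x <= \sum_u \sum_v (gdist u v)%:R * x u * x v.
Proof.
move=> x0; rewrite -block_formE; apply: ler_sum => u _; apply: ler_sum => v _.
by rewrite -!mulrA; apply: ler_wpM2r; rewrite ?mulr_ge0 ?block_dist_le.
Qed.

(** The differences of distances are nonnegative and have positive weights [x u * x v], so a
    vanishing total makes each of them vanish. *)
Lemma block_form_eq (x : G -> R) : (forall u, 0 < x u) ->
  \sum_u \sum_v (gdist u v)%:R * x u * x v <= block_form x ->
  forall u v, (gdist u v)%:R = block_dist u v.
Proof.
move=> x0; rewrite -block_formE -subr_le0 -sumrB => le0 u v.
pose D u v := ((gdist u v)%:R - block_dist u v) * (x u * x v).
have D0 u' v' : 0 <= D u' v'.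
  by rewrite mulr_ge0 ?subr_ge0 ?block_dist_le // mulr_ge0 // ltW.
have sumD : \sum_u \sum_v D u v = 0.
  apply/eqP; rewrite eq_le; apply/andP; split; last first.
    by apply: sumr_ge0 => u' _; apply: sumr_ge0 => v' _.
  move: le0; congr (_ <= _); apply: eq_bigr => u' _; rewrite -sumrB.
  by apply: eq_bigr => v' _; rewrite /D; ring.
have /(psumr_eq0P _)/(_ u isT) := sumD.
rewrite -/(_ -> _) => h; have {h} : \sum_v D u v = 0.
  by apply: h => u' _; apply: sumr_ge0.
move=> /(psumr_eq0P _)/(_ v isT) h; have {h} : D u v = 0 by apply: h.
by move/eqP; rewrite /D mulf_eq0 subr_eq0 (gt_eqF (mulr_gt0 _ _)) // orbF => /eqP.
Qed.

End BlockForm.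

(** * Recognizing the extremal graph *)

Lemma extremal_iso (G : sgraph) (n k : nat) (s0 : G) (W U : {set G}) :
  #|G| = n -> (k + 2 <= n)%N -> #|U| = k.+1 -> #|W| = (n - k - 2)%N ->
  s0 \notin W -> s0 \notin U -> [disjoint W & U] ->
  (forall u v : G, adj u v =
     (u != v) && [|| u == s0, v == s0 | (u \in W) && (v \in W)]) ->
  graph_iso G (extremal_graph n k).
Proof.
move=> cG kn cU cW s0W s0U dWU adjE.
pose w (j : 'I_(n - k - 2)) : G := enum_val (cast_ord (esym cW) j).
pose u (h : 'I_k.+1) : G := enum_val (cast_ord (esym cU) h).
have wW j : w j \in W by exact: enum_valP.
have uU h : u h \in U by exact: enum_valP.
have uW h : u h \notin W by rewrite (disjointFl dWU).
have ws0 j : w j != s0 by apply: contraNneq s0W => <-.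
have us0 h : u h != s0 by apply: contraNneq s0U => <-.
have wu j h : w j != u h by apply: contraNneq (uW h) => <-.
have w_inj : injective w by move=> j j' /enum_val_inj/cast_ord_inj.
have u_inj : injective u by move=> h h' /enum_val_inj/cast_ord_inj.
pose g (x : extremal_graph n k) : G :=
  match x with inl _ => s0 | inr (inl j) => w j | inr (inr h) => u h end.
have g_inj : injective g.
  move=> [i|[j|h]] [i'|[j'|h']] //= => [_|/eqP|/eqP|/eqP|/w_inj->|/eqP|/eqP|/eqP|/u_inj->] //.
  - by rewrite !ord1.
  - by rewrite eq_sym (negPf (ws0 _)).
  - by rewrite eq_sym (negPf (us0 _)).
  - by rewrite (negPf (ws0 _)).
  - by rewrite (negPf (wu _ _)).
  - by rewrite (negPf (us0 _)).
  - by rewrite eq_sym (negPf (wu _ _)).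
have [f gK fK] : bijective g.
  by apply: inj_card_bij => //; rewrite cG !card_sum !card_ord; lia.
exists f; split; first by exists g.
move=> x y; rewrite -{2}(fK x) -{2}(fK y) adjE (inj_eq g_inj).
case: (f x) (f y) => [i|[j|h]] [i'|[j'|h']] //=;
  rewrite ?eqxx ?ord1 ?eqxx ?(negPf (ws0 _)) ?(negPf (us0 _)) ?orbT ?wW
    ?(negPf (uW _)) ?andbF ?andbT //=.
Qed.

(** * The block form on three-valued vectors *)

Section LabelSums.
Variables (R : realType) (T : finType) (P Q : {set T}) (a b c : R).

Definition label (v : T) : R := if v \in P then a else if v \in Q then c else b.

Lemma sum_label (A : {set T}) (g : R -> R) : [disjoint P & Q] ->
  \sum_(v in A) g (label v) =
  #|A :&: P|%:R * (g a - g b) + #|A :&: Q|%:R * (g c - g b) + #|A|%:R * g b.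
Proof.
move=> dPQ; have cnt (D : {set T}) r :
    #|A :&: D|%:R * r = \sum_(v in A) (v \in D)%:R * r.
  rewrite mulr_natl -sumr_const.
  rewrite (eq_bigl (fun v => (v \in A) && (v \in D))) => [|v]; last by rewrite inE.
  rewrite big_mkcondr.
  by apply: eq_bigr => v _; case: (v \in D); rewrite ?mul1r ?mul0r.
rewrite !cnt mulr_natl -sumr_const -!big_split; apply: eq_bigr => v _ /=.
rewrite /label; have [vP|vP] := boolP (v \in P).
  by rewrite (disjointFr dPQ) //=; ring.
by case: (v \in Q) => /=; ring.
Qed.

End LabelSums.

(** The eigenvalue equations make the form of the extremal graph equal to [l] times the squared
    norm. Passing to the block structure moves [s] clique vertices of weight [b] into the cut, which
    loses [2 s t b c], and [p] of them into the independent part, which gains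
    [(2 M p + p^2 - p) b^2]. *)
Lemma perron_gap (R : comRingType) (a b c l m t k s p M : R) :
  t = k + 1 -> p = k * s -> m = s + p + M ->
  l * a = m * b + t * c ->
  l * b = a + (m - 1) * b + 2 * t * c ->
  l * c = a + 2 * m * b + 2 * (t - 1) * c ->
  (a + m * b + t * c) ^+ 2 - (a ^+ 2 + m * b ^+ 2 + t * c ^+ 2)
  + (t * c + (M + p) * b) ^+ 2 - (M * b) ^+ 2 - (t * c ^+ 2 + p * b ^+ 2) =
  l * (a ^+ 2 + m * b ^+ 2 + t * c ^+ 2)
  + b * ((2 * M * p + p ^+ 2 - p) * b - 2 * s * t * c).
Proof.
move=> tE pE mE ea eb ec.
have -> : l * (a ^+ 2 + m * b ^+ 2 + t * c ^+ 2) =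
  a * (l * a) + m * b * (l * b) + t * c * (l * c) by ring.
by rewrite ea eb ec mE pE tE; ring.
Qed.

(** The two inequalities on the right are the input of [cut_gap_false]. For [k >= 4] the factor
    [k (2M + ks - 1)] is at least [4 (k + 1)], and [m < n] finishes; for smaller [k] the case
    [2M + s >= 12] is polynomial arithmetic and the rest a finite check, which yields the
    exceptions. *)
Lemma gap_nat (k s M n m : nat) : (0 < k)%N -> (0 < s)%N -> (0 < M)%N ->
  m = (s + k * s + M)%N -> n = (m + k + 2)%N -> (4 + k * k + 5 * k <= k * n)%N ->
  [/\ k = 1%N, M = 1%N & [\/ s = 3, s = 4 | s = 5]%N] \/
  (2 * k.+1 <= k * (2 * M + k * s - 1))%N /\
  (2 * k.+1 * (m + n + 3) < k * (2 * M + k * s - 1) * (n + 4))%N.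
Proof.
move=> k0 s0 M0 mE nE kn.
have [k4|k4] := leqP 4 k.
  right.
  have h1 : (k.+1 <= 2 * M + k * s - 1)%N by nia.
  have h2 : (4 * k.+1 <= k * (2 * M + k * s - 1))%N by nia.
  split; first by lia.
  by apply: leq_trans (leq_mul h2 (leqnn _)); nia.
have [big|small] := leqP 12 (2 * M + s).
  right; case: k k0 k4 mE nE kn => [|[|[|[|]]]] //= _ _ mE nE kn.
  - split; first by lia.
    by nia.
  - split; first by lia.
    by nia.
  - split; first by lia.
    by nia.
have {small} [s11 M5] : (s <= 11 /\ M <= 5)%N by lia.
case: k k0 k4 mE nE kn => [|[|[|[|]]]] //= _ _ mE nE kn;
  do 12? [case: s s0 s11 mE nE kn => [|s] s0 s11 mE nE kn //];
  do 6? [case: M M0 M5 mE nE kn => [|M] M0 M5 mE nE kn //];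
  first [by exfalso; lia | by right; split; lia
       | by left; split=> //; constructor 1 | by left; split=> //; constructor 2
       | by left; split=> //; constructor 3].
Qed.

(** If some [z] is in [Z], then [B] has at least two vertices, each of weight [b], which together
    outweigh [rho z]. Every summand is therefore positive, and the sum can fail to be positive only
    when it is empty. *)
Lemma block_correction (R : realType) (G : sgraph) (S U : {set G})
    (rho : G -> G) (x : G -> R) (b : R) :
  let B := [set v | (v \notin S) && (rho v \notin U)] in
  let Z := [set v | [&& v \notin S, v \notin U & rho v \in U]] in
  (forall u, u \in U -> u \notin S /\ rho u = u) ->
  (forall z, z \notin S -> z \notin U -> rho z \in U -> (1 < #|B|)%N) ->
  0 < b -> (forall w, w \notin S -> w \notin U -> x w = b) ->
  (forall u, u \in U -> x u < 2 * b) ->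
  let cor := \sum_(z in Z) x z * (\sum_(v in B) x v - x (rho z)) in
  0 <= cor /\ (cor <= 0 -> Z = set0).
Proof.
move=> B Z rhoU B2 b0 xb xU cor.
have sumB : \sum_(v in B) x v = #|B|%:R * b.
  rewrite mulr_natl -sumr_const; apply: eq_bigr => v; rewrite inE.
  move=> /andP[vS rv]; apply: xb => //.
  by apply: contra rv => vU; rewrite (rhoU v vU).2.
have pos z : z \in Z -> 0 < x z * (\sum_(v in B) x v - x (rho z)).
  rewrite inE => /and3P[zS zU rz]; rewrite xb // mulr_gt0 // sumB subr_gt0.
  apply: lt_le_trans (xU _ rz) _; apply: ler_wpM2r; first exact: ltW.
  by rewrite (ler_nat R 2); exact: B2 rz.
split; first by apply: sumr_ge0 => z /pos/ltW.
move=> cor0; apply/eqP; rewrite -subset0; apply/subsetP => z zZ.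
move: cor0; rewrite /cor (bigD1 z) //= leNgt.
by rewrite ltr_wpDr ?pos //; apply: sumr_ge0 => w /andP[/pos/ltW].
Qed.

Lemma label_norm (R : realType) (G : sgraph) (P T : {set G}) (a b c : R) :
  [disjoint P & T] -> \sum_u label P T a b c u ^+ 2 =
  #|P|%:R * a ^+ 2 + #|T|%:R * c ^+ 2 + (#|G|%:R - #|P|%:R - #|T|%:R) * b ^+ 2.
Proof.
move=> dPT.
rewrite (eq_bigl (fun u => u \in [set: G])) => [|u]; last by rewrite inE.
rewrite (sum_label a b c [set: G] (fun r => r ^+ 2) dPT) !setTI cardsT.
ring.
Qed.

Lemma block_form_label (R : realType) (G : sgraph) (S U P T : {set G})
    (rho : G -> G) (a b c : R) :
  let W := ~: (S :|: U) in
  let B := [set v | (v \notin S) && (rho v \notin U)] in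
  let Z := [set v | [&& v \notin S, v \notin U & rho v \in U]] in
  let x := label P T a b c in
  P \subset S -> T \subset U -> [disjoint S & U] ->
  block_form S U rho x =
  (#|P|%:R * a + #|T|%:R * c + (#|G|%:R - #|P|%:R - #|T|%:R) * b) ^+ 2
  - \sum_u x u ^+ 2
  + (#|T|%:R * c + (#|U|%:R + #|W|%:R - #|T|%:R) * b) ^+ 2
  - (#|W|%:R * b) ^+ 2
  - (#|T|%:R * c ^+ 2 + (#|U|%:R - #|T|%:R) * b ^+ 2)
  + 2 * \sum_(z in Z) x z * (\sum_(v in B) x v - x (rho z)).
Proof.
move=> W B Z x PS TU dSU.
have dPT : [disjoint P & T] by apply: disjointWl PS _; apply: disjointWr TU _.
have x1 (A : {set G}) := sum_label a b c A (fun r => r) dPT.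
have x2 := sum_label a b c U (fun r => r ^+ 2) dPT.
have dE (A D : {set G}) : [disjoint A & D] -> #|A :&: D| = 0%N.
  by rewrite -setI_eq0 => /eqP ->; rewrite cards0.
have cSP : #|~: S :&: P| = 0%N.
  by apply: dE; rewrite disjoint_sym disjoints_subset setCK.
have cST : #|~: S :&: T| = #|T|.
  rewrite (setIidPr _) // -disjoints_subset disjoint_sym.
  exact: disjointWr TU dSU.
have cWP : #|W :&: P| = 0%N.
  by apply: dE; rewrite disjoint_sym disjoints_subset setCK subsetU ?PS.
have cWT : #|W :&: T| = 0%N.
  by apply: dE; rewrite disjoint_sym disjoints_subset setCK subsetU ?TU ?orbT.
have cUP : #|U :&: P| = 0%N.
  by apply: dE; rewrite disjoint_sym; exact: disjointWl PS dSU.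
have cCS : #|~: S|%:R = #|U|%:R + #|W|%:R :> R.
  rewrite -natrD; congr _%:R; have := cardsC S; have := cardsC (S :|: U).
  by rewrite -/W cardsU disjoint_setI0 // cards0 subn0; lia.
have sumTE : \sum_u x u = \sum_(u in [set: G]) x u.
  by apply: eq_bigl => u; rewrite inE.
rewrite /block_form sumTE; congr (_ + _); rewrite /x !x1 x2.
rewrite !setTI cSP cST cWP cWT cUP (setIidPr TU) cardsT cCS; ring.
Qed.

(** * Comparison of [G] with the extremal graph for a given cut *)

Section BlockCut.
(* [s] is |S| - 1 and [m] is the order of the clique K_(n-k-2). *)
Variables (R : realType) (k s n : nat) (G : sgraph) (S U : {set G}).
Variable rho : G -> G.
Let W := ~: (S :|: U).
Let B := [set v | (v \notin S) && (rho v \notin U)].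
Let Z := [set v | [&& v \notin S, v \notin U & rho v \in U]].
Let m := (s + k * s + #|W|)%N.

Hypothesis k_gt0 : (0 < k)%N.
Hypothesis connG : connected_graph G.
Hypothesis cardG : #|G| = n.
Hypothesis n_ge : (4 + k * k + 5 * k <= k * n)%N.
Hypothesis lambda1_le :
  lambda1 (dist_mx R G) <= lambda1 (dist_mx R (extremal_graph n k)).
Hypothesis cardS : #|S| = s.+1.
Hypothesis cardU : #|U| = (k * s.+1 + 1)%N.
Hypothesis rhoU : forall u, u \in U -> u \notin S /\ rho u = u.
Hypothesis rho_adj :
  forall u v, u \notin S -> v \notin S -> adj u v -> rho u = rho v.
Hypothesis B_gt0 : (0 < #|B|)%N.
Hypothesis B_gt1 :
  forall z, z \notin S -> z \notin U -> rho z \in U -> (1 < #|B|)%N.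

Lemma cut_disjoint : [disjoint S & U].
Proof. by rewrite disjoint_sym disjoint_subset; apply/subsetP => u /rhoU[]. Qed.

Lemma cut_order : n = (m + k + 2)%N.
Proof.
rewrite -cardG -(cardsC (S :|: U)) cardsU disjoint_setI0 ?cut_disjoint //.
by rewrite cards0 subn0 cardS cardU /m /W; clear; lia.
Qed.

Lemma cut_rest_gt0 : (0 < #|W|)%N.
Proof.
apply: leq_trans B_gt0 (subset_leq_card _); apply/subsetP => v; rewrite !inE.
case/andP=> vS rv; rewrite negb_or vS.
by apply: contra rv => vU; rewrite (rhoU vU).2.
Qed.

Lemma cut_order_real : #|G|%:R = m%:R + k.+1%:R + 1 :> R.
Proof. by rewrite cardG cut_order -natrD natr1; congr _%:R; lia. Qed.

(** Any positive root serves, since the eigenvector it provides is positive. *)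
Lemma cut_lambda1_le (l : R) : 0 < l -> extremal_cubic m%:R k.+1%:R l = 0 ->
  lambda1 (dist_mx R G) <= l.
Proof.
move=> l0 ql; apply: le_trans lambda1_le _.
have m0 : 0 <= m%:R :> R by [].
have t0 : 0 < k.+1%:R :> R by rewrite ltr0n.
have [a [a0 ea eb ec]] := extremal_eigenvector m0 t0 l0 ql.
have mE : m = (n - k - 2)%N by rewrite cut_order; lia.
rewrite mE in ea eb ec m0.
apply: extremal_lambda1_le ea eb ec => //; lra.
Qed.

Lemma cut_form_le (l : R) (x : G -> R) : (forall u, 0 < x u) ->
  lambda1 (dist_mx R G) <= l ->
  \sum_u \sum_v (gdist u v)%:R * x u * x v <= l * \sum_u x u ^+ 2.
Proof.
move=> x0 lamle; apply: le_trans (lambda1_dist_ge _) _.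
by apply: ler_wpM2r lamle; apply: sumr_ge0 => u _; exact: sqr_ge0.
Qed.

(* The Perron vector of the extremal graph, transplanted to [G] with its      *)
(* smallest entry on a vertex of [S] and its largest ones on k+1 vertices     *)
(* of [U].                                                                    *)
Lemma cut_perron_test : exists (l : R) (x : G -> R) (cor : R),
  let p : R := k%:R * s%:R in
  let gap := (2 * #|W|%:R * p + p ^+ 2 - p) * (l + 2)
             - 2 * s%:R * k.+1%:R * (m%:R + l + 1) in
  [/\ m%:R + k.+1%:R + 3 <= l, lambda1 (dist_mx R G) <= l,
      forall u, 0 < x u,
      block_form S U rho x = l * \sum_u x u ^+ 2 + (l + 2) * gap + 2 * cor &
      0 <= cor /\ (cor <= 0 -> Z = set0)].
Proof.
have [s0 s0S] : exists s0, s0 \in S by apply/card_gt0P; rewrite cardS.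
have [T TU cT] : exists2 T : {set G}, T \subset U & #|T| = k.+1.
  by apply: exists_subset_card; rewrite cardU; nia.
have m4 : 4 <= m%:R :> R by rewrite (ler_nat R 4); have := cut_order; nia.
have t2 : 2 <= k.+1%:R :> R by rewrite (ler_nat R 2).
have mt : 7 <= m%:R + k.+1%:R :> R.
  by rewrite -natrD (ler_nat R 7); have := cut_order; nia.
have [l lo ql] := extremal_cubic_root_ge t2 m4 mt.
have l0 : 0 < l by lra.
have m0 : 0 <= m%:R :> R by [].
have t0 : 0 < k.+1%:R :> R by rewrite ltr0n.
have [a [a0]] := extremal_eigenvector m0 t0 l0 ql.
set b := l + 2; set c := m%:R + l + 1 => ea eb ec.
have b0 : 0 < b by rewrite /b; lra.
have c0 : 0 < c by rewrite /c; lra.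
have bc : c < 2 * b by rewrite /c /b; lra.
pose x := label [set s0] T a b c.
exists l, x, (\sum_(z in Z) x z * (\sum_(v in B) x v - x (rho z))).
move=> p gap; split=> //.
- exact: cut_lambda1_le.
- by move=> u; rewrite /x /label; case: ifP => // _; case: ifP.
- have tE : k.+1%:R = k%:R + 1 :> R by rewrite natr1.
  have mE : m%:R = s%:R + p + #|W|%:R by rewrite /m !natrD natrM.
  have normE : \sum_u x u ^+ 2 = a ^+ 2 + m%:R * b ^+ 2 + k.+1%:R * c ^+ 2.
    rewrite label_norm ?cards1 ?cT ?cut_order_real; first by ring.
    rewrite disjoints1; apply/negP => /(subsetP TU)/rhoU[].
    by rewrite s0S.
  rewrite block_form_label ?sub1set ?cut_disjoint // normE; congr (_ + _).
  rewrite /gap -(perron_gap tE (erefl p) mE ea eb ec) -/W.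
  rewrite cards1 cT cut_order_real cardU natrD natrM -natr1 tE /p; ring.
apply: block_correction b0 _ _ => //.
- move=> w wS wU; rewrite /x /label inE ifN ?ifN //.
    by apply: contra wU => /(subsetP TU).
  by apply: contraNneq wS => ->.
move=> u /rhoU[uS _]; rewrite /x /label inE ifN; first by case: ifP => _; lra.
by apply: contraNneq uS => ->.
Qed.

(** The gap is zero here, so the upper bound on the form forces the correction to vanish; hence [Z]
    is empty and all distances equal [block_dist]. Distance 1 then occurs exactly for distinct
    vertices that include [s0] or both lie in [W]. *)
Lemma cut_single_iso : s = 0%N -> graph_iso G (extremal_graph n k).
Proof.
move=> s_eq0.
have [l [x [cor [_ lamle x0 formE [cor0 corZ]]]]] := cut_perron_test.
have {}formE : block_form S U rho x = l * (\sum_u x u ^+ 2) + 2 * cor.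
  by rewrite formE s_eq0; ring.
have form_le := cut_form_le x0 lamle.
have cor_le0 : cor <= 0.
  have := block_form_le connG rhoU rho_adj (fun u => ltW (x0 u)).
  by move: form_le; rewrite formE; lra.
have gE : forall u v, (gdist u v)%:R = block_dist R S U rho u v.
  by apply: (block_form_eq connG rhoU rho_adj x0); rewrite formE; lra.
have [s0 SE] : exists s0, S = [set s0].
  by apply/cards1P; rewrite cardS s_eq0.
have s0S : s0 \in S by rewrite SE inE.
have nE := cut_order.
apply: (@extremal_iso G n k s0 W U) => //.
- by rewrite nE; lia.
- by rewrite cardU s_eq0; lia.
- by rewrite nE /m s_eq0; lia.
- by rewrite !inE s0S.
- by apply/negP => /rhoU[]; rewrite s0S.
- rewrite disjoint_subset; apply/subsetP => w; rewrite !inE negb_or.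
  by case/andP.
move=> u v; have [<-|nuv] := eqVneq u v; first exact: adj_irrefl.
have := gE u v; rewrite /block_dist -/Z -/W (corZ cor_le0) !inE (negPf nuv) SE.
rewrite !inE.
have := @gdist_adj G u v; have := gdist_ge (connG u v) nuv.
case: (adj u v) => /= [d1 /(_ isT) d2|d2 _].
  have -> : gdist u v = 1%N by apply/eqP; rewrite eqn_leq d2.
  by case: (u == s0); case: (v == s0); case: (u \in U); case: (v \in U) => //=; lra.
have : 2 <= (gdist u v)%:R :> R by rewrite (ler_nat R 2).
by case: (u == s0); case: (v == s0); case: (u \in U); case: (v \in U) => //=; lra.
Qed.

(** Up to the factor [s], the gap is affine in [l]. The first inequality makes its slope
    nonnegative, and the second makes it positive at [l = n + 2], which is the lower bound
    [m + (k + 1) + 3] on the root. The form then exceeds [l] times the squared norm. *)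
Lemma cut_gap_false :
  (0 < s)%N -> (2 * k.+1 <= k * (2 * #|W| + k * s - 1))%N ->
  (2 * k.+1 * (m + n + 3) < k * (2 * #|W| + k * s - 1) * (n + 4))%N -> False.
Proof.
move=> s_gt0; have [e eE] : exists e, (2 * #|W| + k * s)%N = e.+1.
  by exists (2 * #|W| + k * s).-1; have := cut_rest_gt0; lia.
rewrite eE subn1 /= -(ler_nat R) => K_ge; rewrite -(ltr_nat R) => K_gt.
have [l [x [cor [lo lamle x0]]]] := cut_perron_test.
set p := k%:R * s%:R; set gap := (X in (l + 2) * X) => formE [cor0 _].
have form_le := cut_form_le x0 lamle.
have := block_form_le connG rhoU rho_adj (fun u => ltW (x0 u)).
rewrite formE => form_ge.
have m0 : 0 <= m%:R :> R by [].
have t0 : 0 < k.+1%:R :> R by rewrite ltr0n.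
have eR : 2 * #|W|%:R + p = e%:R + 1 :> R.
  by rewrite /p natr1 -eE natrD !natrM.
have gapE : gap = s%:R * (k%:R * e%:R * (l + 2) - 2 * k.+1%:R * (m%:R + l + 1)).
  by rewrite /gap; have -> : e%:R = 2 * #|W|%:R + p - 1 :> R; [lra | rewrite /p; ring].
suff : 0 < gap.
  by move=> gap0; have := mulr_gt0 (_ : 0 < l + 2) gap0; lra.
rewrite gapE mulr_gt0 ?ltr0n //.
have nR : n%:R = m%:R + k.+1%:R + 1 :> R by rewrite -cardG cut_order_real.
move: K_ge K_gt; rewrite !natrM !natrD nR -(natrM R k e); set K := (k * e)%:R.
rewrite -subr_ge0 => K_ge K_gt; rewrite -(subr_ge0 _ l) in lo.
by have := mulr_ge0 K_ge lo; lra.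
Qed.

(* Here [G] is close to the join of a clique on [S] with isolated vertices,    *)
(* whose Perron vector is approximately proportional to 5 on [S] and 8 off it. *)
Lemma cut_exception_false :
  k = 1%N -> #|W| = 1%N -> [\/ s = 3, s = 4 | s = 5]%N -> False.
Proof.
move=> k1 W1 sE; pose x : G -> R := label S set0 5 8 8.
have x0 u : 0 < x u by rewrite /x /label; case: ifP => // _; case: ifP.
have b0 : 0 < 8 :> R by lra.
have [||cor0 _] := @block_correction R G S U rho x 8 rhoU B_gt1 b0.
- by move=> w wS _; rewrite /x /label (negPf wS) inE.
- by move=> u /rhoU[uS _]; rewrite /x /label (negPf uS) inE; lra.
have GR : #|G|%:R = 2 * s%:R + 4 :> R.
  by rewrite cut_order_real /m k1 W1 mul1n !natrD; ring.
have SR : #|S|%:R = s%:R + 1 :> R by rewrite cardS natr1.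
have UR : #|U|%:R = s%:R + 2 :> R.
  by rewrite cardU k1 mul1n addn1 -!natr1; ring.
have normE : \sum_u x u ^+ 2 = (s%:R + 1) * 25 + (s%:R + 3) * 64.
  rewrite label_norm ?cards0 ?GR ?SR; first by ring.
  by rewrite -setI_eq0 setI0.
have formE : _ := @block_form_label R G S U S set0 rho 5 8 8 (subxx S) (sub0set U) cut_disjoint.
rewrite -/x -/W normE W1 cards0 GR SR UR in formE.
(* A sign change of the cubic on [[lo, hi]] gives a root there, so [hi] bounds the spectral radius;
   it remains to choose [hi] below the Rayleigh quotient of [x]. *)
have key (lo hi : R) : 0 < lo -> lo <= hi ->
    extremal_cubic m%:R k.+1%:R lo <= 0 -> 0 <= extremal_cubic m%:R k.+1%:R hi ->
    block_form S U rho x <= hi * ((s%:R + 1) * 25 + (s%:R + 3) * 64).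
  move=> lo0 lohi plo phi.
  have [l [lol lhi ql]] := extremal_cubic_root lohi plo phi.
  have l0 : 0 < l by lra.
  apply: le_trans (block_form_le connG rhoU rho_adj (fun u => ltW (x0 u))) _.
  rewrite -normE; apply: cut_form_le => //.
  by apply: le_trans lhi; exact: cut_lambda1_le.
move: key; rewrite formE /extremal_cubic /m k1 W1.
case: sE => ->.
(* Leaving out the nonnegative correction, the quotients are 6060/484, 8676/573 and 11758/662; the
   first barely exceeds 25/2. *)
- move=> /(_ 12 (25 / 2)); lra.
- move=> /(_ 14 15); lra.
- move=> /(_ 14 17); lra.
Qed.

End BlockCut.

(** * From failure of toughness to a vertex cut *)

Theorem theorem1p3 (R : realType) (tau : R) (k : nat) (G : sgraph) (n : nat)
    (tau_gt0 : 0 < tau) (k_gt0 : (0 < k)%N) (tauV : tau^-1 = k%:R)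
    (connG : connected_graph G) (orderG : #|G| = n)
    (n_ge : 4 * tau + tau^-1 + 5 <= n%:R)
    (lambda1_le : lambda1 (dist_mx R G) <=
                  lambda1 (dist_mx R (extremal_graph n k))) :
  ~ graph_iso G (extremal_graph n k) -> tough tau G.
Proof.
move=> not_iso; apply/toughP => S c_gt1; rewrite leNgt; apply/negP => S_lt.
apply: not_iso; set c := num_components _ in c_gt1 S_lt.
have k0 : 0 < k%:R :> R by rewrite ltr0n.
have ktau : k%:R * tau = 1 by rewrite -tauV mulVf // gt_eqF.
(* Multiplying the bound on [n] by [k] clears [tau], because [k * tau = 1]. *)
have n_ge_nat : (4 + k * k + 5 * k <= k * n)%N.
  rewrite -(ler_nat R) !natrD !natrM.
  have := ler_wpM2l (ltW k0) n_ge; rewrite tauV; lra.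
(* Strictness matters: [k * #|S| + 1] components can be chosen for [U] with a largest one left
   out. *)
have cut : (k * #|S| + 1 < c)%N.
  rewrite addn1 -(ltr_nat R) -natr1 natrM -ltrBrDr.
  have c0 : 0 < c%:R - 1 :> R by rewrite subr_gt0 ltr1n.
  move: S_lt; rewrite ltr_pdivrMr // -(ltr_pM2l k0 #|S|%:R).
  by rewrite [X in _ < X -> _]mulrA ktau mul1r.
have S0 := cut_nonempty connG c_gt1.
have [rho [U [cardU rhoU rho_adj B0 B1]]] := cut_blocks cut.
have cardS : #|S| = #|S|.-1.+1 by rewrite (prednK S0).
rewrite cardS in cardU; set s := #|S|.-1 in cardS cardU.
have [s_eq0|s_gt0] := posnP s; first by apply: (@cut_single_iso R k s n G S U rho).
have nE := cut_order orderG cardS cardU rhoU.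
have [[k1 W1 sE]|[K_ge K_gt]] :=
  gap_nat k_gt0 s_gt0 (cut_rest_gt0 rhoU B0) erefl nE n_ge_nat.
  by exfalso; apply: (@cut_exception_false R k s n G S U rho) sE.
by exfalso; apply: (@cut_gap_false R k s n G S U rho) K_gt.
Qed.
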